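(* Let $P$ be a program calling a library $L$ whose code is missing, where library functions contain no allocations, no field is accessed by both $P$ and $L$, and there are no callbacks. Let $\Pi$ be the current set of static points-to edges (computed from the current set $\Pi_{\text{miss}}$ of known counterexamples), let $$\tilde{M}_{\text{alloc}}=\{o\in\mathcal{O}\mid y\hookrightarrow o\in\Pi\text{ for some library call }x\gets m(y)\text{ in }P\},$$ let $M_{\text{call}}$ be the set of all statements $x\gets m(y)$, $m\in\mathcal{M}$, of $P$, and let $\tilde{M}_{\text{min}}=\tilde{M}_{\text{alloc}}\cup M_{\text{call}}$. Suppose $P$ is instrumented using the monitoring scheme $\tilde{M}_{\text{min}}$. If any counterexample (to $\Pi$) occurs during an execution, then some counterexample is reported.
   Context: Programs. The available program $P$ is a finite set of statements over a finite set $\mathcal{V}_P$ of program (visible) variables: allocations $x\gets X()$ ($X$ a class), assignments $x\gets y$, loads $x\gets y.f$, stores $x.f\gets y$ ($f$ a field), and library calls $x\gets m(y)$, where $m\in\mathcal{M}$ is a function of the library $L$ (each has exactly one parameter $p_m$ and a return value $r_m$). $P$ contains no functions of its own. Control flow is not modelled: an execution runs some finite sequence of statements of $P$, starting with all variables null. Library functions are implemented by statements of the same kinds over their own variables (disjoint from $\mathcal{V}_P$). A call $x\gets m(y)$ assigns $y$ to $p_m$, runs the body of $m$, and then assigns $r_m$ to $x$. Standing assumptions: library functions contain no allocation statements; disjoint fields, i.e. no field is accessed both by a load or store of $P$ and by a load or store of the library; no callbacks from the library into $P$. Objects. An abstract object $o\in\mathcal{O}$ is an allocation statement $o=(x\gets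 X())$ of $P$. Each time it is executed it creates a fresh concrete object $\bar o$, said to be allocated at $o$ (written $\bar o\leadsto o$). The dynamic points-to edge $x\hookrightarrow o$ ($x\in\mathcal{V}_P$) occurs in an execution if at some point $x$ points to a concrete object allocated at $o$. Static analysis. Given $\Pi_{\text{miss}}\subseteq\mathcal{V}_P\times\mathcal{O}$, the computed set $\Pi\subseteq\mathcal{V}_P\times\mathcal{O}$ is the least set such that: (1) if $o=(x\gets X())$ is in $P$ then $x\hookrightarrow o\in\Pi$; (2) if $x\gets y$ is in $P$ and $y\hookrightarrow o\in\Pi$ then $x\hookrightarrow o\in\Pi$; (3) if $x\gets y.f$ and $z.f\gets w$ are in $P$ and $y\hookrightarrow o',z\hookrightarrow o',w\hookrightarrow o\in\Pi$ then $x\hookrightarrow o\in\Pi$; (4) $\Pi_{\text{miss}}\subseteq\Pi$. Library calls are treated as no-ops. A counterexample (missing points-to edge) in an execution is a dynamic points-to edge $x\hookrightarrow o$ occurring in it with $x\hookrightarrow o\notin\Pi$. Monitoring. A monitoring scheme $M$ is a set of statements of $P$ of the form $x\gets *$. Each time a statement in $M$ is executed, the pair $(x\gets *,\bar o)$ is recorded, where $\bar o$ is the concrete object $x$ points to afterwards. A recorded pair $(x\gets X(),\bar o)$ reveals $\bar o\leadsto o=(x\gets X())$. For every recorded pair $(x\gets *,\bar o)$ with $\bar o\leadsto o$ revealed in the same execution, the edge $x\hookrightarrow o$ is detected, and if it is not in $\Pi$ it is reported as a counterexample. *)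

(* Defs.v *)
From Stdlib Require List.
From mathcomp Require Import all_boot.
From mathcomp Require Import boolp classical_sets cardinality.

Set Implicit Arguments.
Unset Strict Implicit.
Unset Printing Implicit Defensive.

Local Open Scope classical_set_scope.

Inductive stmt (Var Cls Fld Mth : Type) : Type :=
| SAlloc of Var & Cls            (* x <- X()  *)
| SAssign of Var & Var           (* x <- y    *)
| SLoad of Var & Var & Fld       (* x <- y.f  *)
| SStore of Var & Fld & Var      (* x.f <- y  *)
| SCall of Var & Mth & Var.      (* x <- m(y) *)

Arguments SAlloc {Var Cls Fld Mth} _ _.
Arguments SAssign {Var Cls Fld Mth} _ _.
Arguments SLoad {Var Cls Fld Mth} _ _ _.
Arguments SStore {Var Cls Fld Mth} _ _ _.
Arguments SCall {Var Cls Fld Mth} _ _ _.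

(* The function bodies are, like the program, sets of statements without
   control flow; they may call library functions, never the program. *)
Record library (Var Cls Fld Mth : Type) : Type := Library {
  param : Mth -> Var;
  ret : Mth -> Var;
  body : Mth -> set (stmt Var Cls Fld Mth)
}.

Section Syntax.
Variables (Var Cls Fld Mth : Type).
Local Notation stmt := (stmt Var Cls Fld Mth).
Local Notation library := (library Var Cls Fld Mth).

Definition stmt_vars (s : stmt) : set Var :=
  match s with
  | SAlloc x _ => [set x]
  | SAssign x y | SLoad x y _ | SStore x _ y | SCall x _ y => [set x; y]
  end.

Definition is_alloc (s : stmt) : Prop := exists x X, s = SAlloc x X.

(* [Some x] exactly for the statements of the form x <- * *)
Definition target (s : stmt) : option Var :=
  match s with
  | SAlloc x _ | SAssign x _ | SLoad x _ _ | SCall x _ _ => Some x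
  | SStore _ _ _ => None
  end.

Definition accesses (s : stmt) (f : Fld) : Prop :=
  match s with
  | SLoad _ _ g | SStore _ g _ => g = f
  | _ => False
  end.

Definition program_over (VP : set Var) (P : set stmt) : Prop :=
  [/\ finite_set VP, finite_set P & forall s, P s -> stmt_vars s `<=` VP].

Definition library_vars_disjoint (VP : set Var) (L : library) : Prop :=
  forall m, [/\ ~ VP (param L m), ~ VP (ret L m)
    & forall s, body L m s -> stmt_vars s `&` VP = set0].

Definition no_library_alloc (L : library) : Prop :=
  forall m s, body L m s -> ~ is_alloc s.

Definition disjoint_fields (P : set stmt) (L : library) : Prop :=
  forall s m s' f, P s -> body L m s' -> accesses s f -> ~ accesses s' f.

Definition abstract_objects (P : set stmt) : set stmt :=
  [set o | P o /\ is_alloc o].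

(* An edge (x, o) stands for the points-to edge from x to o. *)
Inductive static_pt (P : set stmt) (miss : set (Var * stmt)) :
    Var * stmt -> Prop :=
| static_alloc x X :
    P (SAlloc x X) -> static_pt P miss (x, SAlloc x X)
| static_assign x y o :
    P (SAssign x y) -> static_pt P miss (y, o) -> static_pt P miss (x, o)
| static_heap x y z w f o o' :
    P (SLoad x y f) -> P (SStore z f w) ->
    static_pt P miss (y, o') -> static_pt P miss (z, o') ->
    static_pt P miss (w, o) -> static_pt P miss (x, o)
| static_miss e : miss e -> static_pt P miss e.

End Syntax.

Section Semantics.
Variables (Var : eqType) (Cls : Type) (Fld : eqType) (Mth : Type).
Local Notation stmt := (stmt Var Cls Fld Mth).
Local Notation library := (library Var Cls Fld Mth).

(* Concrete objects are numbered; [None] is null in [env] and [heap].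
   [site c] is the allocation statement that created c, and [None] when c has
   not been allocated yet. *)
Record state : Type := State {
  env : Var -> option nat;
  heap : nat * Fld -> option nat;
  site : nat -> option stmt
}.

Definition init_state : state :=
  State (fun=> None) (fun=> None) (fun=> None).

Definition set_var (st : state) (x : Var) (v : option nat) : state :=
  State [eta env st with x |-> v] (heap st) (site st).

Definition set_field (st : state) (c : nat) (f : Fld) (v : option nat)
    : state :=
  State (env st) [eta heap st with (c, f) |-> v] (site st).

Definition new_object (st : state) (c : nat) (s : stmt) : state :=
  State (env st) (heap st) [eta site st with c |-> Some s].

(* A load or store through null has no effect. Variables are global: library
   variables keep their values between calls. *)
Inductive exec (L : library) : stmt -> state -> state -> Prop :=
| exec_alloc x X c st : site st c = None ->
    exec L (SAlloc x X) st (set_var (new_object st c (SAlloc x X)) x (Some c))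
| exec_assign x y st :
    exec L (SAssign x y) st (set_var st x (env st y))
| exec_load x y f c st : env st y = Some c ->
    exec L (SLoad x y f) st (set_var st x (heap st (c, f)))
| exec_load_null x y f st : env st y = None ->
    exec L (SLoad x y f) st st
| exec_store x f y c st : env st x = Some c ->
    exec L (SStore x f y) st (set_field st c f (env st y))
| exec_store_null x f y st : env st x = None ->
    exec L (SStore x f y) st st
| exec_call x m y st st' :
    run L (body L m) (set_var st (param L m) (env st y)) st' ->
    exec L (SCall x m y) st (set_var st' x (env st' (ret L m)))
(* [run L B] executes some finite sequence of statements of B *)
with run (L : library) : set stmt -> state -> state -> Prop :=
| run_nil B st : run L B st st
| run_cons B s st st1 st2 :
    B s -> exec L s st st1 -> run L B st1 st2 -> run L B st st2.

(* The statements of the program executed, each with the state that follows *)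
Definition trace : Type := seq (stmt * state).

Fixpoint trace_from (P : set stmt) (L : library) (st : state) (t : trace)
    : Prop :=
  match t with
  | [::] => True
  | (s, st') :: t' => [/\ P s, exec L s st st' & trace_from P L st' t']
  end.

Definition execution (P : set stmt) (L : library) (t : trace) : Prop :=
  trace_from P L init_state t.

(* Visible variables change only when a statement of the program completes,
   so the states recorded in the trace suffice here. *)
Definition dynamic_pt (VP : set Var) (P : set stmt) (t : trace)
    (e : Var * stmt) : Prop :=
  [/\ VP e.1, abstract_objects P e.2
    & exists s st c,
        [/\ List.In (s, st) t, env st e.1 = Some c & site st c = Some e.2]].

Definition counterexample (VP : set Var) (P : set stmt)
    (Pi : set (Var * stmt)) (t : trace) (e : Var * stmt) : Prop :=
  dynamic_pt VP P t e /\ ~ Pi e.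

Definition recorded (M : set stmt) (t : trace) (s : stmt) (c : nat) : Prop :=
  exists st x,
    [/\ List.In (s, st) t, M s, target s = Some x & env st x = Some c].

Definition revealed (M : set stmt) (t : trace) (c : nat) (o : stmt) : Prop :=
  is_alloc o /\ recorded M t o c.

Definition detected (M : set stmt) (t : trace) (e : Var * stmt) : Prop :=
  exists s c,
    [/\ recorded M t s c, target s = Some e.1 & revealed M t c e.2].

Definition reported (M : set stmt) (Pi : set (Var * stmt)) (t : trace)
    (e : Var * stmt) : Prop :=
  detected M t e /\ ~ Pi e.

End Semantics.

Section Schemes.
Variables (Var Cls Fld Mth : Type).
Local Notation stmt := (stmt Var Cls Fld Mth).

Definition M_alloc (P : set stmt) (Pi : set (Var * stmt)) : set stmt :=
  [set o | abstract_objects P o /\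
           exists x m y, P (SCall x m y) /\ Pi (y, o)].

Definition M_call (P : set stmt) : set stmt :=
  [set s | P s /\ exists x m y, s = SCall x m y].

Definition M_min (P : set stmt) (Pi : set (Var * stmt)) : set stmt :=
  M_alloc P Pi `|` M_call P.

End Schemes.

(* Main.v *)
Require Import Defs.
From mathcomp Require Import all_boot.
From mathcomp Require Import boolp classical_sets cardinality.

Local Open Scope classical_set_scope.

(** Call an object escaped when its allocation site lies in [M_alloc]. As long
    as no counterexample has occurred, every object that the program hands to
    the library has escaped. By the disjointness of fields, library variables
    and library fields then only ever hold escaped objects, and the heap edges
    that the program loads were written by its own stores, which [static_pt]
    accounts for. Hence the first counterexample can only be created by the
    assignment of the return value of a call: that statement is monitored, and
    so is the allocation of the escaped object it returns. *)

Section Invariant.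
Context {Var : eqType} {Cls : Type} {Fld : eqType} {Mth : Type}.
Local Notation stmt := (stmt Var Cls Fld Mth).
Local Notation state := (state Var Cls Fld Mth).
Local Notation trace := (trace Var Cls Fld Mth).

Scheme exec_run_ind := Minimality for exec Sort Prop
  with run_exec_ind := Minimality for run Sort Prop.

Context (VP : set Var) (P : set stmt) (L : library Var Cls Fld Mth).
Context (miss : set (Var * stmt)) (T : trace).
Local Notation Pi := (static_pt P miss).

Definition library_stmt (s : stmt) : Prop := exists m, body L m s.

Definition escaped (st : state) (c : nat) : Prop :=
  exists2 o, site st c = Some o & M_alloc P Pi o.

(** The premises of [static_heap] that come from the store side; a later load by [P] only has to
    supply the rest. *)
Definition program_edge (st : state) (c : nat) (f : Fld) (c' : nat) : Prop :=
  exists z w o o',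
    [/\ P (SStore z f w), site st c = Some o, site st c' = Some o', Pi (z, o)
      & Pi (w, o')].

(** Nothing is asked of the object holding the field: the library may write into any object it
    reaches, but [P] never loads such a field. *)
Definition library_edge (st : state) (f : Fld) (c' : nat) : Prop :=
  (exists2 s, library_stmt s & accesses s f) /\ escaped st c'.

(* The allocations are looked up in the fixed trace [T] of the whole execution,
   so that [site_inv] is stable along it. *)
Record invariant (st : state) : Prop := Invariant {
  visible_inv : forall x c, VP x -> env st x = Some c ->
    exists2 o, site st c = Some o & Pi (x, o);
  hidden_inv : forall x c, ~ VP x -> env st x = Some c -> escaped st c;
  heap_inv : forall c f c', heap st (c, f) = Some c' ->
    program_edge st c f c' \/ library_edge st f c';
  site_inv : forall c o, site st c = Some o -> P o /\
    exists x X st',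
      [/\ o = SAlloc x X, List.In (o, st') T & env st' x = Some c]
}.

Lemma invariant_init : invariant (init_state _ _ _ _).
Proof. by split. Qed.

Lemma invariant_set_hidden st x v :
  ~ VP x -> (forall c, v = Some c -> escaped st c) ->
  invariant st -> invariant (set_var st x v).
Proof.
move=> VPx vP [vis hid hp si]; split => //= z c VPz; case: eqP => [zx|_].
- by case: VPx; rewrite -zx.
- exact: vis.
- exact: vP.
- exact: hid.
Qed.

Lemma invariant_set_visible st x v :
  VP x ->
  (forall c, v = Some c -> exists2 o, site st c = Some o & Pi (x, o)) ->
  invariant st -> invariant (set_var st x v).
Proof.
move=> VPx vP [vis hid hp si]; split => //= z c VPz; case: eqP => [zx|_].
- by rewrite zx; exact: vP.
- exact: vis.
- by case: VPz; rewrite zx.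
- exact: hid.
Qed.

Lemma invariant_set_field st c f v :
  (forall c', v = Some c' -> program_edge st c f c' \/ library_edge st f c') ->
  invariant st -> invariant (set_field st c f v).
Proof.
move=> vP [vis hid hp si]; split => //= d g d'.
by case: eqP => [[-> ->]|_]; [exact: vP | exact: hp].
Qed.

(** As [c] is fresh, [site] only gains a value, so all facts about older objects persist in [st'];
    the new edge comes from [static_alloc]. *)
Lemma invariant_alloc st st' x X c :
  VP x -> P (SAlloc x X) -> site st c = None ->
  st' = set_var (new_object st c (SAlloc x X)) x (Some c) ->
  List.In (SAlloc x X, st') T ->
  invariant st -> invariant st'.
Proof.
move=> VPx Ps fresh est' inT [vis hid hp si].
have mono d o : site st d = Some o -> site st' d = Some o.
  by rewrite est' /=; case: eqP => // ->; rewrite fresh.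
have escmono d : escaped st d -> escaped st' d.
  by move=> [o /mono sd Mo]; exists o.
split.
- move=> z d VPz; rewrite {1}est' /=; case: eqP => [-> [<-]|_ ed].
    by exists (SAlloc x X); [rewrite est' /= eqxx | exact: static_alloc].
  by have [o /mono] := vis _ _ VPz ed; exists o.
- move=> z d VPz; rewrite {1}est' /=; case: eqP => [zx|_ ed].
    by case: VPz; rewrite zx.
  by apply: escmono; apply: hid ed.
- move=> d f d'; rewrite {1}est' /= => /hp [|[? /escmono]]; last by right.
  move=> [z [w [o [o' [? /mono ? /mono ? ? ?]]]]].
  by left; exists z, w, o, o'.
- move=> d o; rewrite {1}est' /=; case: eqP => [-> [<-]|_ /si //].
  split=> //; exists x, X, st'; split=> //.
  by rewrite est' /= eqxx.
Qed.

Hypotheses (overP : program_over VP P) (disjV : library_vars_disjoint VP L).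
Hypotheses (noalloc : no_library_alloc L) (disjF : disjoint_fields P L).

Lemma library_stmt_vars s x : library_stmt s -> stmt_vars s x -> ~ VP x.
Proof.
move=> [m ms] sx VPx; have [_ _ /(_ s ms) e] := disjV m.
by have : (stmt_vars s `&` VP) x by []; rewrite e.
Qed.

(** A [program_edge] would put [f] in a store of [P] as well, against the disjointness of fields. *)
Lemma escaped_field st f c c' s :
  invariant st -> library_stmt s -> accesses s f ->
  heap st (c, f) = Some c' -> escaped st c'.
Proof.
move=> I [m ms] sf /(heap_inv _ I) [|[]//].
by move=> [z [w [o [o' [Ps _ _ _ _]]]]]; case: (disjF _ _ _ f Ps ms erefl).
Qed.

(** Without allocations, the library only copies values among its own variables and fields, and
    these are all escaped. *)
Lemma library_run_invariant m st st' :
  run L (body L m) st st' -> invariant st -> invariant st'.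
Proof.
(* Nested calls run other bodies, so the mutual induction is over arbitrary sets of library
   statements instead of one fixed body. *)
move=> r; suff: body L m `<=` library_stmt -> invariant st -> invariant st'.
  by apply=> s ms; exists m.
pose Pe s st st' := library_stmt s -> invariant st -> invariant st'.
pose Pr B st st' := B `<=` library_stmt -> invariant st -> invariant st'.
have hid x s st1 : library_stmt s -> stmt_vars s x -> invariant st1 ->
    forall c, env st1 x = Some c -> escaped st1 c.
  by move=> ls sx I c; apply: hidden_inv => //; exact: library_stmt_vars ls sx.
apply: (run_exec_ind _ _ _ _ L Pe Pr) r; rewrite /Pe /Pr => {m st st' Pe Pr}.
- by move=> x X c st _ [m ms]; case: (noalloc _ _ ms); exists x, X.
- move=> x y st ls I; apply: invariant_set_hidden => //.
    exact: library_stmt_vars ls (or_introl erefl).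
  exact: hid ls (or_intror erefl) I.
- move=> x y f c st _ ls I; apply: invariant_set_hidden => //.
    exact: library_stmt_vars ls (or_introl erefl).
  by move=> c'; exact: escaped_field ls erefl.
- by [].
- move=> x f y c st _ ls I; apply: invariant_set_field => // c' yc'.
  right; split; first by exists (SStore x f y).
  exact: hid ls (or_intror erefl) I _ yc'.
- by [].
- move=> x m y st st' _ IH ls I; have [VPp VPr _] := disjV m.
  have I' : invariant st'.
    apply: IH; first by move=> s ms; exists m.
    by apply: invariant_set_hidden => //; exact: hid ls (or_intror erefl) I.
  apply: invariant_set_hidden => //.
    exact: library_stmt_vars ls (or_introl erefl).
  by move=> c; exact: hidden_inv.
- by [].
- move=> B s st st1 st2 Bs _ IHs _ IHB subB I.
  by apply: IHB => //; exact: IHs (subB _ Bs) I.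
Qed.

(** [site_inv] finds the allocation event in [T], and the site is monitored because it lies in
    [M_alloc]. *)
Lemma escaped_revealed st c o :
  invariant st -> site st c = Some o -> escaped st c ->
  revealed (M_min P Pi) T c o.
Proof.
move=> I sc [o']; rewrite sc => -[<-] Mo.
have [_ [x [X [st' [eo inT xc]]]]] := site_inv _ I _ _ sc.
split; first by exists x, X.
by exists st', x; split=> //; [left | rewrite eo].
Qed.

(** The conclusion of the theorem, offered as the alternative to preserving the invariant, so that
    the induction may stop at the first failure. *)
Definition some_reported : Prop :=
  exists e, counterexample VP P Pi T e /\ reported (M_min P Pi) Pi T e.

Lemma call_invariant st st1 x m y :
  let st' := set_var st1 x (env st1 (ret L m)) in
  P (SCall x m y) -> List.In (SCall x m y, st') T ->
  run L (body L m) (set_var st (param L m) (env st y)) st1 ->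
  invariant st -> invariant st' \/ some_reported.
Proof.
move=> /= Ps inT r I; have [VPp VPr _] := disjV m.
have [_ _ /(_ _ Ps) subVP] := overP.
have VPx : VP x by apply: subVP; left.
have VPy : VP y by apply: subVP; right.
have I1 : invariant st1.
  (* The argument has escaped: its static edge from [y] and this very call put its site in
     [M_alloc]. *)
  apply: library_run_invariant r _; apply: invariant_set_hidden => // c yc.
  have [o sc Pyo] := visible_inv _ I _ _ VPy yc.
  have [Po [z [Z [? [eo _ _]]]]] := site_inv _ I _ _ sc.
  exists o => //; split; last by exists x, m, y.
  by split=> //; exists z, Z.
case rc: (env st1 (ret L m)) => [c|]; last first.
  by left; exact: invariant_set_visible.
rewrite rc in inT.
have esc := hidden_inv _ I1 _ _ VPr rc; have [o sc [Po _]] := (esc).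
(* The returned object has escaped, so a new edge outside [Pi] is recorded by this call and its site
   is revealed. *)
have [Pxo|nPxo] := EM (Pi (x, o)).
  by left; apply: invariant_set_visible => // _ [<-]; exists o.
right; exists (x, o); split; split=> //.
- split=> //; exists (SCall x m y), (set_var st1 x (Some c)), c.
  by split=> //=; rewrite eqxx.
- exists (SCall x m y), c; split=> //; last exact: escaped_revealed I1 sc esc.
  exists (set_var st1 x (Some c)), x; split=> //=; last by rewrite eqxx.
  by right; split=> //; exists x, m, y.
Qed.

(** Every statement other than a call is matched by a rule of [static_pt] or by the heap clause, so
    only a call can yield [some_reported]. *)
Lemma exec_invariant s st st' :
  P s -> List.In (s, st') T -> exec L s st st' -> invariant st ->
  invariant st' \/ some_reported.
Proof.
move=> Ps inT ex I; have [_ _ /(_ _ Ps) subVP] := overP.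
case: ex Ps inT I subVP => {s st st'}; last first.
- by move=> x m y st st' r Ps inT I _; exact: call_invariant r I.
- by left.
- move=> x f y c st xc Ps _ I subVP; left.
  apply: invariant_set_field => // c' yc'; left.
  have [o so Pxo] := visible_inv _ I _ _ (subVP _ (or_introl erefl)) xc.
  have [o' so' Pyo'] := visible_inv _ I _ _ (subVP _ (or_intror erefl)) yc'.
  by exists x, y, o, o'.
- by left.
- move=> x y f c st yc Ps _ I subVP; left.
  apply: invariant_set_visible => //; first by apply: subVP; left.
  move=> c' /(heap_inv _ I) [|[[s [m ms] sf] _]]; last first.
    by case: (disjF _ _ _ f Ps ms erefl).
  move=> [z [w [o [o' [Pz so so' Pzo Pwo']]]]]; exists o' => //.
  (* The object [c] has a single site, so [y] and the stored-through [z] share the static object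
     that [static_heap] requires. *)
  have [o1] := visible_inv _ I _ _ (subVP _ (or_intror erefl)) yc.
  by rewrite so => -[<-] Pyo; exact: static_heap Ps Pz Pyo Pzo Pwo'.
- move=> x y st Ps _ I subVP; left.
  apply: invariant_set_visible => //; first by apply: subVP; left.
  move=> c /(visible_inv _ I _ _ (subVP _ (or_intror erefl))) [o so Pyo].
  by exists o => //; exact: static_assign Ps Pyo.
- move=> x X c st fresh Ps inT I subVP; left.
  by apply: (invariant_alloc st _ x X c _ Ps fresh _ inT I) => //; apply: subVP.
Qed.

(** The induction consumes [t] while the invariant refers to the whole trace [T], hence the
    inclusion. *)
Lemma trace_invariant st t :
  List.incl t T -> trace_from P L st t -> invariant st ->
  (forall s st', List.In (s, st') t -> invariant st') \/ some_reported.
Proof.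
elim: t st => [|[s st'] t IH] st tT /=; first by left.
move=> [Ps ex tr] I.
have [I'|] := exec_invariant _ _ _ Ps (tT _ (or_introl erefl)) ex I; last by right.
have [It|] := IH _ (fun p pt => tT p (or_intror pt)) tr I'; last by right.
by left=> s' st'' [[_ <-]|/It].
Qed.

End Invariant.

Theorem proposition2 (Var : eqType) (Cls : Type) (Fld : eqType) (Mth : Type)
    (VP : set Var) (P : set (stmt Var Cls Fld Mth))
    (L : library Var Cls Fld Mth)
    (miss : set (Var * stmt Var Cls Fld Mth))
    (t : trace Var Cls Fld Mth) :
  program_over VP P ->
  library_vars_disjoint VP L ->
  no_library_alloc L ->
  disjoint_fields P L ->
  miss `<=` VP `*` abstract_objects P ->
  execution P L t ->
  (exists e, counterexample VP P (static_pt P miss) t e) ->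
  exists e, counterexample VP P (static_pt P miss) t e /\
            reported (M_min P (static_pt P miss)) (static_pt P miss) t e.
Proof.
move=> overP disjV noalloc disjF _ tr [[x o] [[/= VPx _ dyn] nPi]].
have := trace_invariant VP P L miss t overP disjV noalloc disjF _ t
  (fun p pt => pt) tr (invariant_init VP P L miss t).
(* If the invariant held throughout, [visible_inv] would place the given counterexample in [Pi]. *)
move=> [It|//]; have [s [st [c [st_t xc so]]]] := dyn.
have [o'] := visible_inv _ _ _ _ _ _ (It _ _ st_t) _ _ VPx xc.
by rewrite so => -[<-].
Qed.
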